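(* Let $\mathcal{X}$ be a discrete function space on a tree $T$. The differentiation operator $D$ is bounded on $\mathcal{X}$ if and only if the composition operator $C_b$ is bounded on $\mathcal{X}$.
   Context: A tree $T$ is a locally finite, connected, simply-connected graph, identified with its set of vertices. A vertex is terminal if it has a unique neighbor; all trees are assumed to be without terminal vertices (hence infinite) and rooted at a vertex $o$. For $v\neq o$, $v^-$ denotes the unique neighbor of $v$ lying on the path from $o$ to $v$ (the parent of $v$). A function on $T$ is a complex-valued function on its vertices. The backward shift map $b:T\to T$ is $b(v)=v^-$ for $v\neq o$ and $b(o)=o$. The derivative of $f:T\to\mathbb{C}$ is $f'(v)=f(v)-f(b(v))$ for all $v\in T$ (so $f'(o)=0$). A functional Banach space on a set $\Omega$ is a Banach space of complex-valued functions on $\Omega$ with pointwise vector operations, such that $f(x)=g(x)$ for all $x\in\Omega$ implies $f=g$, $f(x)=f(y)$ for every $f$ in the space implies $x=y$, and for each $x\in\Omega$ the linear functional $f\mapsto f(x)$ is continuous. A discrete function space $\mathcal{X}$ on $T$ is a functional Banach space whose elements are functions on $T$, with norm $\|\cdot\|_{\mathcal{X}}$. The differentiation operator is $Df=f'$, and the composition operator induced by $b$ is $C_bf=f\circ b$. An operator is bounded on $\mathcal{X}$ if it is a bounded linear operator from $\mathcal{X}$ to $\mathcal{X}$. *)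

(* Defs.v *)
From HB Require Import structures.
From mathcomp Require Import all_boot all_order all_algebra.
From mathcomp Require Import complex.
From mathcomp Require Import all_classical all_reals all_analysis.

Set Implicit Arguments.
Unset Strict Implicit.
Unset Printing Implicit Defensive.

Import Order.TTheory GRing.Theory Num.Theory.
Import numFieldNormedType.Exports.

Local Open Scope classical_set_scope.
Local Open Scope ring_scope.

(* A rooted tree without terminal vertices, identified with its vertex set.
   A one-dimensional complex is simply connected iff it is connected and has no
   simple cycle of length at least 3.  [tree_infinite] only discards the
   one-vertex graph, whose vertex has no neighbor and so is not terminal. *)
Record rootedTree := RootedTree {
  vertex :> choiceType;
  adj : rel vertex;
  root : vertex;
  adj_sym : symmetric adj;
  adj_irr : irreflexive adj;
  tree_locally_finite : forall v, finite_set [set w | adj v w];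
  tree_connected : forall v w, exists2 p, path adj v p & last v p = w;
  tree_acyclic : forall c, ucycle adj c -> (size c <= 2)%N;
  tree_no_terminal : forall v, ~ (exists! w, adj v w);
  tree_infinite : infinite_set [set: vertex]
}.

Section Shift.
Variable T : rootedTree.
Local Notation o := (root T).

Definition on_path_from_root (v u : T) :=
  exists p, [/\ path (@adj T) o p, last o p = v, uniq (o :: p) & u \in o :: p].

Definition is_parent (v u : T) := adj v u /\ on_path_from_root v u.

Definition parent (v : T) : T := xget o [set u | is_parent v u].

Definition backward_shift (v : T) : T := if v == o then o else parent v.

Lemma parent_exists (v : T) : v != o -> exists u, is_parent v u.
Proof.
move=> vo; have [p pP pv] := tree_connected o v.
case: (shortenP pP) pv => q qP qU _ qv.
case: (lastP q) qP qU qv => [|q' x] qP qU /=.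
  by move=> ov; rewrite ov eqxx in vo.
rewrite last_rcons => xv; subst x.
exists (last o q'); split.
  by move: qP; rewrite rcons_path adj_sym => /andP[].
exists (rcons q' v); split => //; first by rewrite last_rcons.
by rewrite -rcons_cons mem_rcons inE mem_last orbT.
Qed.

Lemma on_path_avoid (v u : T) : v != o -> is_parent v u ->
  exists p, [/\ path (@adj T) o p, last o p = u & v \notin o :: p].
Proof.
move=> vo [avu [p [pP pv pU up]]].
case: (lastP p) pP pU pv up => [|q x] pP pU /=.
  by move=> ov; rewrite ov eqxx in vo.
rewrite last_rcons => xv; subst x.
rewrite -rcons_cons mem_rcons inE => /orP[/eqP uv|uq].
  by rewrite uv adj_irr in avu.
move: pP pU; rewrite rcons_path -rcons_cons rcons_uniq => /andP[qP _] /andP[vq _].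
case: (splitPl uq) qP vq => p1 p2 lp1; rewrite cat_path => /andP[p1P _].
rewrite -cat_cons mem_cat negb_or => /andP[vp1 _].
by exists p1.
Qed.

Lemma parent_unique (v u u' : T) :
  v != o -> is_parent v u -> is_parent v u' -> u = u'.
Proof.
move=> vo Pu Pu'; have [p [pP pu vp]] := on_path_avoid vo Pu.
have [p' [pP' pu' vp']] := on_path_avoid vo Pu'.
have [//|/eqP uu'] := eqVneq u u'; exfalso.
have rP : path (@adj T) u (rev (belast o p)).
  rewrite -pu rev_path.
  by rewrite (eq_path (e' := @adj T))// => x y; rewrite adj_sym.
have lr : last u (rev (belast o p)) = o.
  by case: (p) pu => [//|x s] _; rewrite /= rev_cons last_rcons.
have wP : path (@adj T) u (rev (belast o p) ++ p').
  by rewrite cat_path rP lr.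
have wl : last u (rev (belast o p) ++ p') = u' by rewrite last_cat lr.
have vw : v \notin u :: (rev (belast o p) ++ p').
  rewrite inE mem_cat mem_rev !negb_or; apply/and3P; split.
  - by apply: contraNneq vp => ->; rewrite -pu mem_last.
  - by apply: contraNN vp; exact: mem_belast.
  - by move: vp'; rewrite inE negb_or => /andP[].
case: (shortenP wP) wl => q qP qU sq ql.
have : ucycle (@adj T) (v :: u :: q).
  rewrite /ucycle /= rcons_path qP ql Pu.1 (adj_sym u') Pu'.1 /=.
  move: qU => /= ->; rewrite andbT.
  by apply: contraNN vw; rewrite !inE => /orP[->//|/sq ->]; rewrite orbT.
by move/tree_acyclic; case: q ql {qP qU sq} => //= ql _.
Qed.

Lemma parentP (v : T) : v != o -> is_parent v (parent v).
Proof. by move=> /parent_exists[u Pu]; exact: (@xgetI _ _ _ u Pu). Qed.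

Variable C : zmodType.

Definition derivative (f : T -> C) : T -> C :=
  fun v => f v - f (backward_shift v).

Definition composition_shift (f : T -> C) : T -> C := f \o backward_shift.

End Shift.

(* A complex Banach space [fspace] whose elements are identified with functions
   on Omega through evaluation.  Linearity of [feval] says that the vector
   operations are pointwise ([R[i]^o] is R[i] as a vector space over itself). *)
Record functionalBanachSpace (R : realType) (Omega : Type) :=
    FunctionalBanachSpace {
  fspace :> completeNormedModType R[i];
  feval : {linear fspace -> (Omega -> R[i]^o)};
  feval_inj : forall f g : fspace, (forall x, feval f x = feval g x) -> f = g;
  feval_separates : forall x y : Omega,
    (forall f, feval f x = feval f y) -> x = y;
  feval_continuous : forall x : Omega, continuous (fun f => feval f x)
}.

Definition discreteFunctionSpace (R : realType) (T : rootedTree) :=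
  functionalBanachSpace R T.

Definition bounded_linear (R : realType) (V : normedModType R[i])
    (A : {linear V -> V}) :=
  exists M : R, forall f, `|A f| <= M%:C%C * `|f|.

(* [L] maps X into X and the induced map X -> X is a bounded linear operator. *)
Definition bounded_on (R : realType) (Omega : Type)
    (X : functionalBanachSpace R Omega)
    (L : (Omega -> R[i]) -> (Omega -> R[i])) :=
  exists A : {linear X -> X},
    (forall f, feval X (A f) = L (feval X f)) /\ bounded_linear A.

(* Main.v *)
Require Import Defs.
From mathcomp Require Import all_boot all_order all_algebra.
From mathcomp Require Import complex.
From mathcomp Require Import all_classical all_reals all_analysis.

(** On functions, the derivative is the identity minus composition with the
    backward shift, and so the composition operator is the identity minus the
    derivative.  The identity is bounded on every space, so it is enough that
    [id - L] is bounded as soon as [L] is ([bounded_on_id_sub]); both directions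
    are instances of that lemma. *)

Import Order.TTheory GRing.Theory Num.Theory.
Local Open Scope ring_scope.

(** The relation between [L] and [L'] is only asked for pointwise, so that it
    can be read in either direction between two operators. *)
Lemma bounded_on_id_sub (R : realType) (Omega : Type)
    (X : functionalBanachSpace R Omega) (L L' : (Omega -> R[i]) -> Omega -> R[i]) :
  (forall f x, L' f x = f x - L f x) -> bounded_on X L -> bounded_on X L'.
Proof.
move=> L'E [A [AL [M AM]]].
pose B : {linear X -> X} := idfun \- A.
exists B; split=> [f|].
  by apply/funext => x; rewrite L'E -AL /B /= linearB.
exists (1 + M) => f.
rewrite rmorphD rmorph1 mulrDl mul1r.
exact: le_trans (ler_normB _ _) (lerD (lexx _) (AM f)).
Qed.

Theorem theorem2p7 (R : realType) (T : rootedTree)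
    (X : discreteFunctionSpace R T) :
  bounded_on X (@derivative T R[i]) <-> bounded_on X (@composition_shift T R[i]).
Proof.
split; apply: bounded_on_id_sub => f v //.
by rewrite /derivative subKr.
Qed.
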